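(* Let $\Sigma,\Sigma_1,\Sigma_0\subset\mathbf P^5$ be the sets of singular lines of the non-singular quadratic line complexes $\mathcal X=G\cap Q$, $\mathcal X_1=G\cap Q_1$, $\mathcal X_0=G\cap Q_0$ respectively (all defined in the context). (a) $\Sigma=\mathcal X\cap\left\{\sum_{i=1}^3a_i^2X_iY_i=0\right\}$. (b) $\Sigma_1=\mathcal X_1\cap\left\{\sum_{i=1}^3a_i^2X_iY_i+b_1b_3X_2^2+b_2b_3X_3^2+b_2b_4Y_2^2+b_1b_4Y_3^2=0\right\}$. (c) $\Sigma_0=\mathcal X_0\cap Q_0'$, where $Q_0'$ is the quadric $$a^2\sum_{i=1}^3X_iY_i+b_5b_7X_1^2+(b_1b_3+b_6b_7)X_2^2+b_2b_3X_3^2+b_6b_8Y_1^2+(b_2b_4+b_5b_8)Y_2^2+b_1b_4Y_3^2$$ $$+(b_1b_5+b_4b_7)X_1Y_3+(b_2b_6+b_3b_8)X_3Y_1+(b_2b_7+b_3b_5)X_1X_3+(b_1b_8+b_4b_6)Y_1Y_3=0.$$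
   Context: $k$ is an algebraically closed field of characteristic $2$. $\mathbf P^5$ has homogeneous coordinates $(X_1,X_2,X_3,Y_1,Y_2,Y_3)$ and $\mathbf P^3$ has homogeneous coordinates $(x,y,z,t)$. $G=\{\sum_{i=1}^3X_iY_i=0\}\subset\mathbf P^5$ is identified with the Grassmannian $G(2,4)$ of lines in $\mathbf P^3$ by the Plücker embedding: the line through $(x,y,z,t)$ and $(x',y',z',t')$ has coordinates $X_1=xt'+tx'$, $X_2=xz'+zx'$, $X_3=xy'+yx'$, $Y_1=yz'+zy'$, $Y_2=yt'+ty'$, $Y_3=zt'+tz'$. Three kinds of second quadrics are considered, with all constants in $k$: (a) $Q:\ \sum_{i=1}^3(a_iX_iY_i+c_iX_i^2+d_iY_i^2)=0$ with $a_1,a_2,a_3$ pairwise distinct; (b) $Q_1:\ \sum_{i=1}^3(a_iX_iY_i+c_iX_i^2+d_iY_i^2)+b_1X_2Y_3+b_2X_3Y_2+b_3X_2X_3+b_4Y_2Y_3=0$ with $a_1\neq a_2=a_3$; (c) $Q_0:\ \sum_{i=1}^3(aX_iY_i+c_iX_i^2+d_iY_i^2)+b_1X_2Y_3+b_2X_3Y_2+b_3X_2X_3+b_4Y_2Y_3+b_5X_1Y_2+b_6X_2Y_1+b_7X_1X_2+b_8Y_1Y_2=0$. In (b) and (c) there are $\alpha_i,\beta_i,\gamma_i,\delta_i\in k$ $(i=1,2,3)$ with $\alpha_i\delta_i+\beta_i\gamma_i=1$ such that $b_1=\beta_3\gamma_2$, $b_2=\alpha_2\delta_3$, $b_3=\gamma_2\delta_3$,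 $b_4=\alpha_2\beta_3$ and (in case (c)) $b_5=\beta_2\gamma_1$, $b_6=\alpha_1\delta_2$, $b_7=\gamma_1\delta_2$, $b_8=\alpha_1\beta_2$. In particular $b_1b_2=b_3b_4$ and $b_5b_6=b_7b_8$. $\mathcal X=G\cap Q$, $\mathcal X_1=G\cap Q_1$, $\mathcal X_0=G\cap Q_0$ are assumed non-singular (each then contains no plane). For $\mathfrak p\in\mathbf P^3$, $\sigma(\mathfrak p)\subset G$ denotes the plane of all lines through $\mathfrak p$; for a plane $\mathfrak h\subset\mathbf P^3$, $\sigma(\mathfrak h)\subset G$ denotes the plane of all lines contained in $\mathfrak h$. For $u\in\mathcal X$, the line in $\mathbf P^3$ corresponding to $u$ is called singular if $u$ is a singular point of the conic $\sigma(\mathfrak p)\cap Q$ for some $\mathfrak p$ (respectively of $\sigma(\mathfrak h)\cap Q$ for some $\mathfrak h$), and $\Sigma=\{u\in\mathcal X:\text{the line corresponding to }u\text{ is singular}\}$. $\Sigma_1$ and $\Sigma_0$ are defined in the same way from $(\mathcal X_1,Q_1)$ and $(\mathcal X_0,Q_0)$. *)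

(* Defs.v *)
From HB Require Import structures.
From mathcomp Require Import all_boot all_order all_algebra.
From mathcomp Require Import mpoly.

Set Implicit Arguments.
Unset Strict Implicit.
Unset Printing Implicit Defensive.

Import GRing.Theory.
Local Open Scope ring_scope.

Section ProjectiveSchemes.
Variables (k : fieldType) (n : nat).

(* A point of the projective space with n homogeneous coordinates is given by a
   nonzero row vector; subsets are scaling-invariant predicates on them. *)
Definition zero_locus (fs : seq {mpoly k[n]}) (u : 'rV[k]_n) : Prop :=
  u != 0 /\ forall f, f \in fs -> f.@[u 0] = 0.

Definition jacobian (fs : seq {mpoly k[n]}) (u : 'rV[k]_n) :
    'M[k]_(size fs, n) :=
  \matrix_(i, j) (fs`_i)^`M(j).@[u 0].

(* Singular points in the sense of the Jacobian criterion for an intersection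
   of codimension size fs. *)
Definition singular_point (fs : seq {mpoly k[n]}) (u : 'rV[k]_n) : Prop :=
  zero_locus fs u /\ (\rank (jacobian fs u) < size fs)%N.

Definition nonsingular (fs : seq {mpoly k[n]}) : Prop :=
  forall u, ~ singular_point fs u.

Definition parametrizes m (M : 'M[k]_(m, n)) (P : 'rV[k]_n -> Prop) : Prop :=
  row_free M /\ forall u, P u <-> u != 0 /\ (u <= M)%MS.

(* The pullback of f along the parametrization s |-> s *m M. *)
Definition pullback m (f : {mpoly k[n]}) (M : 'M[k]_(m, n)) : {mpoly k[m]} :=
  f \mPo [tuple \sum_(i < m) M i j *: 'X_i | j < n].

End ProjectiveSchemes.

(* u is a singular point of the plane curve cut out by f on the plane P. *)
Definition singular_point_in_plane (k : fieldType) n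
    (P : 'rV[k]_n -> Prop) (f : {mpoly k[n]}) (u : 'rV[k]_n) : Prop :=
  exists (M : 'M[k]_(3, n)) (s : 'rV[k]_3),
    [/\ parametrizes M P, u = s *m M & singular_point [:: pullback f M] s].

Section LineComplexes.
Variable k : fieldType.

Definition i1 : 'I_3 := @Ordinal 3 0 isT.
Definition i2 : 'I_3 := @Ordinal 3 1 isT.
Definition i3 : 'I_3 := @Ordinal 3 2 isT.

Definition X (i : 'I_3) : {mpoly k[6]} := 'X_(lshift 3 i).
Definition Y (i : 'I_3) : {mpoly k[6]} := 'X_(rshift 3 i).

Definition grassmannian : {mpoly k[6]} := \sum_(i < 3) X i * Y i.

Definition plucker (p q : 'rV[k]_4) : 'rV[k]_6 :=
  let x := p 0 0 in let y := p 0 1 in let z := p 0 2 in let t := p 0 3 in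
  let x' := q 0 0 in let y' := q 0 1 in let z' := q 0 2 in let t' := q 0 3 in
  \row_(j < 6) [:: x * t' + t * x'; x * z' + z * x'; x * y' + y * x';
                   y * z' + z * y'; y * t' + t * y'; z * t' + t * z']`_j.

(* u is a vector of homogeneous coordinates of the line of P^3 spanned by the
   two rows of l. *)
Definition line_coordinates (l : 'M[k]_(2, 4)) (u : 'rV[k]_6) : Prop :=
  row_free l /\ exists2 c : k, c != 0 & u = c *: plucker (row 0 l) (row 1 l).

Definition lines_through (p : 'rV[k]_4) (u : 'rV[k]_6) : Prop :=
  exists2 l, line_coordinates l u & (p <= l)%MS.

Definition lines_in (h : 'M[k]_(3, 4)) (u : 'rV[k]_6) : Prop :=
  exists2 l, line_coordinates l u & (l <= h)%MS.

Definition line_complex (Q : {mpoly k[6]}) : seq {mpoly k[6]} :=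
  [:: grassmannian; Q].

(* The set of singular lines has two definitions, through the conics on the
   planes of lines through a point and on the planes of lines in a plane. *)
Definition singular_lines_pt (Q : {mpoly k[6]}) (u : 'rV[k]_6) : Prop :=
  zero_locus (line_complex Q) u /\
  exists2 p : 'rV[k]_4, p != 0 & singular_point_in_plane (lines_through p) Q u.

Definition singular_lines_pl (Q : {mpoly k[6]}) (u : 'rV[k]_6) : Prop :=
  zero_locus (line_complex Q) u /\
  exists2 h : 'M[k]_(3, 4),
    row_free h & singular_point_in_plane (lines_in h) Q u.

Definition singular_lines_are (Q Q' : {mpoly k[6]}) : Prop :=
  forall u : 'rV[k]_6,
    (singular_lines_pt Q u <->
       zero_locus (line_complex Q) u /\ zero_locus [:: Q'] u) /\
    (singular_lines_pl Q u <->
       zero_locus (line_complex Q) u /\ zero_locus [:: Q'] u).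

Definition diagonal_part (a c d : 'I_3 -> k) : {mpoly k[6]} :=
  \sum_(i < 3) (a i *: (X i * Y i) + c i *: X i ^+ 2 + d i *: Y i ^+ 2).

Definition quadric_a (a c d : 'I_3 -> k) : {mpoly k[6]} := diagonal_part a c d.

Definition quadric_b (a c d : 'I_3 -> k) (b1 b2 b3 b4 : k) : {mpoly k[6]} :=
  diagonal_part a c d
  + b1 *: (X i2 * Y i3) + b2 *: (X i3 * Y i2)
  + b3 *: (X i2 * X i3) + b4 *: (Y i2 * Y i3).

Definition quadric_c (a : k) (c d : 'I_3 -> k) (b1 b2 b3 b4 b5 b6 b7 b8 : k) :
    {mpoly k[6]} :=
  diagonal_part (fun=> a) c d
  + b1 *: (X i2 * Y i3) + b2 *: (X i3 * Y i2)
  + b3 *: (X i2 * X i3) + b4 *: (Y i2 * Y i3)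
  + b5 *: (X i1 * Y i2) + b6 *: (X i2 * Y i1)
  + b7 *: (X i1 * X i2) + b8 *: (Y i1 * Y i2).

Definition sing_quadric_a (a : 'I_3 -> k) : {mpoly k[6]} :=
  \sum_(i < 3) a i ^+ 2 *: (X i * Y i).

Definition sing_quadric_b (a : 'I_3 -> k) (b1 b2 b3 b4 : k) : {mpoly k[6]} :=
  \sum_(i < 3) a i ^+ 2 *: (X i * Y i)
  + (b1 * b3) *: X i2 ^+ 2 + (b2 * b3) *: X i3 ^+ 2
  + (b2 * b4) *: Y i2 ^+ 2 + (b1 * b4) *: Y i3 ^+ 2.

Definition sing_quadric_c (a b1 b2 b3 b4 b5 b6 b7 b8 : k) : {mpoly k[6]} :=
  a ^+ 2 *: (\sum_(i < 3) X i * Y i)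
  + (b5 * b7) *: X i1 ^+ 2 + (b1 * b3 + b6 * b7) *: X i2 ^+ 2
  + (b2 * b3) *: X i3 ^+ 2 + (b6 * b8) *: Y i1 ^+ 2
  + (b2 * b4 + b5 * b8) *: Y i2 ^+ 2 + (b1 * b4) *: Y i3 ^+ 2
  + (b1 * b5 + b4 * b7) *: (X i1 * Y i3) + (b2 * b6 + b3 * b8) *: (X i3 * Y i1)
  + (b2 * b7 + b3 * b5) *: (X i1 * X i3) + (b1 * b8 + b4 * b6) *: (Y i1 * Y i3).

End LineComplexes.

(* Main.v *)
(* In characteristic 2 the polar form of a quadric Q is alternating, so it can
   be written (u, v) |-> <N u, v>, where <_, _> is the polar form of the
   Grassmannian G.  Let P be a plane of lines through a point, or in a plane,
   that contains the point u of G and Q.  Then u is singular on the conic P and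
   Q iff N u is orthogonal to P, i.e. iff N u lies in P, because P is a maximal
   isotropic subspace.  Conversely <u, N u> = 0, so as soon as G(N u) = 0 the
   span of u and N u is totally singular for G and lies in a plane of each of
   the two families.  Hence the singular lines are cut out by G(N u) = 0, which
   for the quadrics at hand is the stated equation. *)
Require Import Defs.
From mathcomp Require Import all_boot all_order all_algebra.
From mathcomp Require Import mpoly ring.
Import GRing.Theory.
Local Open Scope ring_scope.

(** * Chain rule for multivariate polynomials *)

Lemma submm (n : nat) (m : 'X_{1..n}) : (m - m)%MM = 0%MM.
Proof. by apply/mnmP => i; rewrite mnmBE mnm0E subnn. Qed.

(** The identity holds for constants and variables and is stable under products by the Leibniz rule,
    hence it holds for monomials; linearity gives the rest. *)
Lemma mderiv_comp (n m : nat) (R : comNzRingType) (lq : n.-tuple {mpoly R[m]})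
    (f : {mpoly R[n]}) (i : 'I_m) :
  (f \mPo lq)^`M(i) = \sum_(j < n) (f^`M(j) \mPo lq) * (tnth lq j)^`M(i).
Proof.
pose D (f : {mpoly R[n]}) :=
  (f \mPo lq)^`M(i) = \sum_(j < n) (f^`M(j) \mPo lq) * (tnth lq j)^`M(i).
have D1 : D 1.
  rewrite /D comp_mpoly1 -[1]mpolyC1 mderivC big1 // => j _.
  by rewrite mderivC raddf0 mul0r.
have DM p q : D p -> D q -> D (p * q).
  rewrite /D => Dp Dq; rewrite rmorphM /= mderivM Dp Dq mulr_suml mulr_sumr.
  rewrite -big_split; apply: eq_bigr => j _ /=.
  by rewrite mderivM raddfD /= !rmorphM /=; ring.
have DX j : D 'X_j.
  rewrite /D comp_mpolyXU (bigD1 j) //= big1 ?addr0 => [|l ne_lj].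
    rewrite mderivX mnm1E eqxx scale1r submm mpolyX0 comp_mpoly1 mul1r.
    by rewrite (tnth_nth 0).
  rewrite mderivX mnm1E eq_sym (negPf ne_lj) scale0r.
  by rewrite raddf0 mul0r.
have DXm (m' : 'X_{1..n}) : D 'X_[m'].
  rewrite mpolyXE_id; apply: (big_ind D) => // j _.
  by elim: (m' j) => [|e IHe]; rewrite ?expr0 // exprS; apply: DM.
elim/mpolyind: f => [|c m' p _ _ Dp]; rewrite -/(D _).
  by rewrite /D !raddf0 big1 // => j _; rewrite !raddf0 mul0r.
have DXm' := DXm m'; rewrite /D in Dp DXm' *.
rewrite raddfD /= comp_mpolyZ mderivD mderivZ Dp DXm' scaler_sumr -big_split.
apply: eq_bigr => j _ /=.
by rewrite mderivD mderivZ raddfD /= comp_mpolyZ mulrDl scalerAl.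
Qed.

(** * Ring computations in characteristic 2 *)

Lemma ring2_consts (k : fieldType) : 2%N \in [pchar k] ->
  [/\ (2 : k) = 0, (-1 : k) = 1, (3 : k) = 1, (4 : k) = 0 & (-2 : k) = 0].
Proof.
move=> char2; have two0 : (2 : k) = 0 by exact: pcharf0 char2.
have n1 : (-1 : k) = 1 by rewrite oppr_pchar2.
split=> //; last by rewrite two0 oppr0.
  by rewrite -[3]/(1 + 2 : k) two0 addr0.
by rewrite (natrD _ 2 2) two0 addr0.
Qed.

(* [ring : h] uses a numerical equation h only on the coefficients equal to its
   left-hand side, hence one equation per coefficient that occurs. *)
Ltac ring2 char2 := have [? ? ? ? ?] := ring2_consts _ char2;
  match goal with
  | h0 : 2 = 0, h1 : -1 = 1, h2 : 3 = 1, h3 : 4 = 0, h4 : -2 = 0 |- _ =>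
    ring : h0 h1 h2 h3 h4
  end.

Ltac ring2_with char2 e := have [? ? ? ? ?] := ring2_consts _ char2;
  match goal with
  | h0 : 2 = 0, h1 : -1 = 1, h2 : 3 = 1, h3 : 4 = 0, h4 : -2 = 0 |- _ =>
    ring : e h0 h1 h2 h3 h4
  end.

Section LineComplexes.
Set Implicit Arguments.
Unset Strict Implicit.
Variable k : fieldType.
Implicit Types u v w : 'rV[k]_6.

(** * Gradients and restriction to a linear subspace *)

Definition gradient n (f : {mpoly k[n]}) (u : 'rV[k]_n) : 'rV[k]_n :=
  \row_j f^`M(j).@[u 0].

Lemma pullback_meval m n (f : {mpoly k[n]}) (M : 'M[k]_(m, n)) (s : 'rV[k]_m) :
  (pullback f M).@[s 0] = f.@[(s *m M) 0].
Proof.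
rewrite comp_mpoly_meval; apply: meval_eq => j; rewrite tnth_mktuple mxE.
rewrite raddf_sum /=; apply: eq_bigr => i _.
by rewrite mevalZ mevalXU mulrC.
Qed.

(** Chain rule for the linear substitution [s *m M], whose [j]-th component has partial derivatives
    [M i j]. *)
Lemma gradient_pullback m n (f : {mpoly k[n]}) (M : 'M[k]_(m, n))
    (s : 'rV[k]_m) :
  gradient (pullback f M) s = gradient f (s *m M) *m M^T.
Proof.
apply/rowP => i; rewrite !mxE mderiv_comp raddf_sum /=; apply: eq_bigr => j _.
rewrite mevalM -/(pullback _ M) pullback_meval !mxE; congr (_ * _).
rewrite tnth_mktuple (raddf_sum (mderiv i)) /= raddf_sum (bigD1 i) //=.
rewrite big1 ?addr0 => [|l ne_li].
  rewrite mderivZ mderivX mnm1E eqxx scale1r submm mpolyX0.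
  by rewrite mevalZ meval1 mulr1.
by rewrite mderivZ mderivX mnm1E (negPf ne_li) scale0r scaler0 raddf0.
Qed.

(** * Explicit coordinates and the polar form of the Grassmannian *)

Definition row6 (x1 x2 x3 y1 y2 y3 : k) : 'rV[k]_6 :=
  \row_(j < 6) [:: x1; x2; x3; y1; y2; y3]`_j.

(** Case analysis on this view turns vector identities into scalar identities in six variables. *)
Variant row6_spec : 'rV[k]_6 -> Type :=
  Row6Spec x1 x2 x3 y1 y2 y3 : row6_spec (row6 x1 x2 x3 y1 y2 y3).

Lemma row6P u : row6_spec u.
Proof.
have -> : u = row6 (u 0 (@Ordinal 6 0 isT)) (u 0 (@Ordinal 6 1 isT))
  (u 0 (@Ordinal 6 2 isT)) (u 0 (@Ordinal 6 3 isT)) (u 0 (@Ordinal 6 4 isT))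
  (u 0 (@Ordinal 6 5 isT)).
  apply/rowP; case=> [[|[|[|[|[|[|//]]]]]] lt]; rewrite !mxE /=;
  by congr (_ _ _); apply: val_inj.
by constructor.
Qed.

Definition row4 (x y z t : k) : 'rV[k]_4 := \row_(j < 4) [:: x; y; z; t]`_j.

Variant row4_spec : 'rV[k]_4 -> Type :=
  Row4Spec x y z t : row4_spec (row4 x y z t).

Lemma row4P p : row4_spec p.
Proof.
have -> : p = row4 (p 0 0) (p 0 1) (p 0 2) (p 0 3).
  apply/rowP; case=> [[|[|[|[|//]]]] lt]; rewrite !mxE /=;
  by congr (_ _ _); apply: val_inj.
by constructor.
Qed.

Lemma plucker_row4 x y z t x' y' z' t' :
  plucker (row4 x y z t) (row4 x' y' z' t') =
  row6 (x * t' + t * x') (x * z' + z * x') (x * y' + y * x')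
       (y * z' + z * y') (y * t' + t * y') (z * t' + t * z').
Proof. by rewrite /plucker !mxE. Qed.

Lemma add_row6 x1 x2 x3 y1 y2 y3 x1' x2' x3' y1' y2' y3' :
  row6 x1 x2 x3 y1 y2 y3 + row6 x1' x2' x3' y1' y2' y3' =
  row6 (x1 + x1') (x2 + x2') (x3 + x3') (y1 + y1') (y2 + y2') (y3 + y3').
Proof. by apply/rowP; case=> [[|[|[|[|[|[|//]]]]]] lt]; rewrite !mxE. Qed.

Lemma scale_row6 c x1 x2 x3 y1 y2 y3 :
  c *: row6 x1 x2 x3 y1 y2 y3 =
  row6 (c * x1) (c * x2) (c * x3) (c * y1) (c * y2) (c * y3).
Proof. by apply/rowP; case=> [[|[|[|[|[|[|//]]]]]] lt]; rewrite !mxE. Qed.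

Lemma add_row4 x y z t x' y' z' t' :
  row4 x y z t + row4 x' y' z' t' = row4 (x + x') (y + y') (z + z') (t + t').
Proof. by apply/rowP; case=> [[|[|[|[|//]]]] lt]; rewrite !mxE. Qed.

Lemma scale_row4 c x y z t :
  c *: row4 x y z t = row4 (c * x) (c * y) (c * z) (c * t).
Proof. by apply/rowP; case=> [[|[|[|[|//]]]] lt]; rewrite !mxE. Qed.

Definition row_simp :=
  (add_row4, scale_row4, plucker_row4, add_row6, scale_row6).

(* Gram matrix of the polar form of the Grassmannian. *)
Definition polarity : 'M[k]_6 := \matrix_(i, j) ((i + 3) %% 6 == j)%N%:R.

Lemma row6_polarity x1 x2 x3 y1 y2 y3 :
  row6 x1 x2 x3 y1 y2 y3 *m polarity = row6 y1 y2 y3 x1 x2 x3.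
Proof.
apply/rowP; case=> [[|[|[|[|[|[|//]]]]]] lt];
by rewrite !mxE !big_ord_recl big_ord0 !mxE /= !mulr0 mulr1 ?add0r ?addr0.
Qed.

Lemma polarity_involutive : polarity *m polarity = 1%:M.
Proof.
rewrite -[LHS]mul1mx; apply/row_matrixP => i; rewrite row_mul mulmxA.
by case: (row6P (row i 1%:M)) => *; rewrite !row6_polarity.
Qed.

Definition polar (u v : 'rV[k]_6) : k := (u *m polarity *m v^T) 0 0.

Lemma polar_row6 x1 x2 x3 y1 y2 y3 x1' x2' x3' y1' y2' y3' :
  polar (row6 x1 x2 x3 y1 y2 y3) (row6 x1' x2' x3' y1' y2' y3') =
  y1 * x1' + y2 * x2' + y3 * x3' + x1 * y1' + x2 * y2' + x3 * y3'.
Proof.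
rewrite /polar row6_polarity !mxE !big_ord_recl big_ord0 !mxE /=; ring.
Qed.

Lemma grassmannian_row6 x1 x2 x3 y1 y2 y3 :
  (grassmannian k).@[row6 x1 x2 x3 y1 y2 y3 0] = x1 * y1 + x2 * y2 + x3 * y3.
Proof.
rewrite /grassmannian raddf_sum !big_ord_recl big_ord0 /X /Y /=.
rewrite !mevalM !mevalXU.
by rewrite !mxE /= addr0 addrA.
Qed.

(** * Lines of projective space and their Plücker coordinates *)

Hypothesis char2 : 2%N \in [pchar k].

Local Notation pf u := ((grassmannian k).@[u 0]).

(** The factor is the determinant of the change of basis, whose sign disappears in characteristic
    2. *)
Lemma plucker_comb (a b c d : k) (p q : 'rV[k]_4) :
  plucker (a *: p + b *: q) (c *: p + d *: q) = (a * d + b * c) *: plucker p q.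
Proof.
case: (row4P p) => ? ? ? ?; case: (row4P q) => ? ? ? ?; rewrite !row_simp.
congr row6; ring2 char2.
Qed.

Lemma grassmannian_plucker p q : pf (plucker p q) = 0 :> k.
Proof.
case: (row4P p) => ? ? ? ?; case: (row4P q) => ? ? ? ?.
rewrite row_simp grassmannian_row6; ring2 char2.
Qed.

(** The coordinates are the 2 x 2 minors of [p] and [q]; if they vanish, [q] is [q 0 i / p 0 i]
    times [p] for any [i] with [p 0 i] nonzero. *)
Lemma plucker_eq0 (p q : 'rV[k]_4) : p != 0 -> plucker p q = 0 -> (q <= p)%MS.
Proof.
move=> p0 pq0.
have [i pnz] : exists i, p 0 i != 0.
  apply/existsP; apply: contraNT p0; rewrite negb_exists => /forallP p0.
  by apply/eqP/rowP => i; rewrite mxE; apply/eqP; rewrite -[_ == _]negbK p0.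
suff pqij j : p 0 i * q 0 j = p 0 j * q 0 i.
  have -> : q = (q 0 i / p 0 i) *: p.
    by apply/rowP=> j; rewrite mxE; apply: (mulfI pnz); rewrite pqij; field.
  exact: scalemx_sub.
have opp x : - x = x :> k by rewrite oppr_pchar2.
move: pq0 => /rowP pq0; have := (pq0 0, pq0 1, pq0 2, pq0 3, pq0 4, pq0 5).
move: i j {pnz}; case: (row4P p) => ? ? ? ?; case: (row4P q) => ? ? ? ?.
rewrite !mxE /= => i j.
do 5![case]; rewrite !(rwP eqP) !addr_eq0 !opp -!(rwP eqP) => h1 h2 h3 h4 h5 h6.
by case: i j => [[|[|[|[|//]]]] lt] [[|[|[|[|//]]]] lt']; rewrite !mxE.
Qed.

Lemma row_free_sub_row n (l : 'M[k]_(2, n)) (v : 'rV[k]_n) :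
  row_free l -> (l <= v)%MS = false.
Proof.
move=> /eqP rl; apply/negP => /mxrankS; rewrite rl => le2.
by have := leq_trans le2 (rank_leq_row v).
Qed.

Lemma sub_mx2 m n (l : 'M[k]_(2, n)) (h : 'M[k]_(m, n)) :
  (row 0 l <= h)%MS -> (row 1 l <= h)%MS -> (l <= h)%MS.
Proof.
move=> l0 l1; apply/row_subP => -[[|[|//]] lt].
  by rewrite (_ : Ordinal lt = 0) //; apply: val_inj.
by rewrite (_ : Ordinal lt = 1) //; apply: val_inj.
Qed.

Lemma mul_mx2 n (c : 'rV[k]_2) (l : 'M[k]_(2, n)) :
  c *m l = c 0 0 *: row 0 l + c 0 1 *: row 1 l.
Proof.
rewrite mulmx_sum_row !big_ord_recl big_ord0 addr0.
by have -> : lift ord0 ord0 = 1 :> 'I_2 by apply: val_inj.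
Qed.

Lemma sub_mx2P n (l : 'M[k]_(2, n)) (p : 'rV[k]_n) :
  (p <= l)%MS -> exists a b, p = a *: row 0 l + b *: row 1 l.
Proof.
move=> /submxP[c ->]; exists (c 0 0), (c 0 1); exact: mul_mx2.
Qed.

Lemma mx2_rows n (p q : 'rV[k]_n) :
  exists l : 'M[k]_(2, n), row 0 l = p /\ row 1 l = q.
Proof. by exists (\matrix_(i < 2) if i == 0 then p else q); rewrite !rowK. Qed.

Lemma plucker_neq0 (l : 'M[k]_(2, 4)) :
  row_free l -> plucker (row 0 l) (row 1 l) != 0.
Proof.
move=> rl; apply/negP => /eqP pl0.
have [l0|l0] := eqVneq (row 0 l) 0.
  by have := row_free_sub_row (row 1 l) rl; rewrite sub_mx2 // l0 sub0mx.
by have := row_free_sub_row (row 0 l) rl; rewrite sub_mx2 // plucker_eq0.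
Qed.

(** Pairing a vanishing combination of the rows with either row gives one of its coefficients times
    the nonzero Plücker vector. *)
Lemma plucker_row_free (l : 'M[k]_(2, 4)) :
  plucker (row 0 l) (row 1 l) != 0 -> row_free l.
Proof.
move=> pl0; have plD := plucker_comb _ _ _ _ (row 0 l) (row 1 l).
apply: inj_row_free => v vl0.
have pl00 q : plucker 0 q = 0 :> 'rV[k]_6.
  have := plucker_comb 0 0 0 1 0 q.
  by rewrite !(mul0r, scale0r, scale1r, add0r).
have pl01 q : plucker q 0 = 0 :> 'rV[k]_6.
  have := plucker_comb 0 1 0 0 0 q.
  by rewrite !(mul0r, mulr0, scale0r, scale1r, add0r).
have vE : v 0 0 *: row 0 l + v 0 1 *: row 1 l = 0.
  by rewrite -mul_mx2.
have := plD (v 0 0) (v 0 1) 0 1; have := plD 1 0 (v 0 0) (v 0 1).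
rewrite vE pl00 pl01 mul0r mul1r mulr0 mulr1 !addr0.
move=> /esym/eqP; rewrite scaler_eq0 (negPf pl0) orbF => /eqP v1.
move=> /esym/eqP; rewrite scaler_eq0 (negPf pl0) orbF => /eqP v0.
apply/rowP => -[[|[|//]] lt]; rewrite mxE.
  by rewrite -[RHS]v0; congr (v _ _); apply: val_inj.
by rewrite -[RHS]v1; congr (v _ _); apply: val_inj.
Qed.

Lemma line_of_grassmannian u :
  u != 0 -> pf u = 0 -> exists l, line_coordinates l u.
Proof.
move=> u0 qu0.
suff [c [p [q [c0 pqE]]]] : exists c p q, c != 0 /\ plucker p q = c *: u.
  have [l [l0 l1]] := mx2_rows p q; exists l; split.
    by apply: plucker_row_free; rewrite l0 l1 pqE scaler_eq0 negb_or c0.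
  by exists c^-1; rewrite ?invr_eq0 // l0 l1 pqE scalerA mulVf // scale1r.
move: u0 qu0; case: (row6P u) => x1 x2 x3 y1 y2 y3 u0.
rewrite grassmannian_row6 -addrA => /eqP.
rewrite addr_eq0 oppr_pchar2 // => /eqP x1y1.
(* Rows of the alternating 4 x 4 matrix with Pluecker coordinates u; any two
   independent ones span the line. *)
pose rx := row4 0 x3 x2 x1; pose ry := row4 x3 0 y1 y2.
pose rz := row4 x2 y1 0 y3; pose rt := row4 x1 y2 y3 0.
(* By the relation G(u) = 0, the two rows indexed by the position of a coordinate in the matrix have
   as Plücker vector that coordinate times u, so a nonzero coordinate is picked. *)
have [x10|x10] := eqVneq x1 0; last first.
  exists x1, rx, rt; split=> //; rewrite !row_simp; congr row6;
  ring2_with char2 x1y1.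
have [x20|x20] := eqVneq x2 0; last first.
  exists x2, rx, rz; split=> //; rewrite !row_simp; congr row6;
  ring2_with char2 x1y1.
have [x30|x30] := eqVneq x3 0; last first.
  exists x3, rx, ry; split=> //; rewrite !row_simp; congr row6;
  ring2_with char2 x1y1.
have [y10|y10] := eqVneq y1 0; last first.
  exists y1, ry, rz; split=> //; rewrite !row_simp; congr row6;
  ring2_with char2 x1y1.
have [y20|y20] := eqVneq y2 0; last first.
  exists y2, ry, rt; split=> //; rewrite !row_simp; congr row6;
  ring2_with char2 x1y1.
have [y30|y30] := eqVneq y3 0; last first.
  exists y3, rz, rt; split=> //; rewrite !row_simp; congr row6;
  ring2_with char2 x1y1.
case/eqP: u0; rewrite x10 x20 x30 y10 y20 y30.
by apply/rowP; case=> [[|[|[|[|[|[|//]]]]]] lt]; rewrite !mxE.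
Qed.

(** * Incidence of lines and the polar form *)

(** Laplace expansion along the first two rows: the determinant is the sum of products of
    complementary 2 x 2 minors, without signs in characteristic 2. *)
Lemma det4 (A : 'M[k]_4) (a b c d : 'rV[k]_4) :
  row 0 A = a -> row 1 A = b -> row 2 A = c -> row 3 A = d ->
  \det A = polar (plucker a b) (plucker c d).
Proof.
move=> ra rb rc rd.
have -> : A = \matrix_(i < 4, j < 4) [:: a; b; c; d]`_i 0 j.
  have rowA (i : 'I_4) r : row i A = r -> forall j, A i j = r 0 j.
    by move=> <- j; rewrite mxE.
  apply/matrixP; case=> [[|[|[|[|//]]]] lt] j; rewrite mxE /=.
  - by rewrite -(rowA _ _ ra); congr (A _ _); apply: val_inj.
  - by rewrite -(rowA _ _ rb); congr (A _ _); apply: val_inj.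
  - by rewrite -(rowA _ _ rc); congr (A _ _); apply: val_inj.
  - by rewrite -(rowA _ _ rd); congr (A _ _); apply: val_inj.
case: (row4P a) => ? ? ? ?; case: (row4P b) => ? ? ? ?.
case: (row4P c) => ? ? ? ?; case: (row4P d) => ? ? ? ?.
rewrite !row_simp polar_row6.
rewrite (expand_det_row _ ord0) !big_ord_recl big_ord0 /cofactor.
rewrite !(expand_det_row _ ord0) !big_ord_recl !big_ord0 /cofactor.
rewrite !(expand_det_row _ ord0) !big_ord_recl !big_ord0 /cofactor.
rewrite !det_mx11 !mxE /=.
ring2 char2.
Qed.

Lemma polarZ c u v : polar (c *: u) v = c * polar u v.
Proof. by rewrite /polar -!scalemxAl mxE. Qed.

Lemma polarZr c u v : polar u (c *: v) = c * polar u v.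
Proof. by rewrite /polar linearZ /= -scalemxAr mxE. Qed.

Lemma grassmannianZ c u : pf (c *: u) = c ^+ 2 * pf u.
Proof. case: (row6P u) => *; rewrite scale_row6 !grassmannian_row6; ring. Qed.

Lemma line_coordinates_neq0 l u : line_coordinates l u -> u != 0.
Proof.
by case=> rl [c c0 ->]; rewrite scaler_eq0 negb_or c0 plucker_neq0.
Qed.

Lemma grassmannian_line l u : line_coordinates l u -> pf u = 0.
Proof.
by case=> _ [c _ ->]; rewrite grassmannianZ grassmannian_plucker ?mulr0.
Qed.

(** By [det4] the polar form is, up to nonzero factors, the determinant of the four spanning
    vectors, which vanishes exactly when the lines meet. *)
Lemma polar_lines_eq0 l l' u u' :
  line_coordinates l u -> line_coordinates l' u' ->
  (polar u u' == 0) = (\rank (l + l')%MS < 4)%N.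
Proof.
case=> _ [c c0 ->] [_ [c' c'0 ->]]; rewrite polarZ polarZr !mulf_eq0.
rewrite (negPf c0) (negPf c'0) /=.
have r (i : 'I_2) : (row (lshift 2 i) (col_mx l l') = row i l)
                    * (row (rshift 2 i) (col_mx l l') = row i l').
  by rewrite rowKu rowKd.
rewrite -(@det4 (col_mx l l')).
- rewrite addsmxE ltn_neqAle rank_leq_row andbT.
  rewrite -[_ == 4]/(row_free (col_mx l l')) row_free_unit.
  by rewrite unitmxE unitfE negbK.
- by rewrite -r; congr row; apply: val_inj.
- by rewrite -r; congr row; apply: val_inj.
- by rewrite -r; congr row; apply: val_inj.
- by rewrite -r; congr row; apply: val_inj.
Qed.

Lemma polar_lines_through (p : 'rV[k]_4) : p != 0 ->
  forall u u', lines_through p u -> lines_through p u' -> polar u u' = 0.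
Proof.
move=> p0 u u' [l lu pl] [l' lu' pl'].
apply/eqP; rewrite (polar_lines_eq0 lu lu').
case: lu lu' => /eqP rl _ [/eqP rl' _].
rewrite -(ltn_add2r (\rank (l :&: l')%MS)) mxrank_sum_cap rl rl'.
rewrite -[ltnLHS]addn0 ltn_add2l lt0n mxrank_eq0; apply: contraNneq p0 => cap0.
by rewrite -submx0 -cap0 sub_capmx pl.
Qed.

Lemma polar_lines_in (h : 'M[k]_(3, 4)) :
  forall u u', lines_in h u -> lines_in h u' -> polar u u' = 0.
Proof.
move=> u u' [l lu lh] [l' lu' lh']; apply/eqP; rewrite (polar_lines_eq0 lu lu').
by rewrite ltnS (leq_trans (mxrankS _) (rank_leq_row h)) // addsmx_sub lh.
Qed.

(** * The two families of planes on the Grassmannian *)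

Lemma line_coordinates_plucker (p q : 'rV[k]_4) : plucker p q != 0 ->
  exists2 l, line_coordinates l (plucker p q) & row 0 l = p /\ row 1 l = q.
Proof.
move=> pq0; have [l [l0 l1]] := mx2_rows p q; exists l => //.
split; first by apply: plucker_row_free => //; rewrite l0 l1.
by exists 1; rewrite ?oner_eq0 // l0 l1 scale1r.
Qed.

Lemma row_free_base m n (A : 'M[k]_(m, n)) r : \rank A = r ->
  exists2 M : 'M[k]_(r, n), row_free M & (M :=: A)%MS.
Proof.
by move=> <-; exists (row_base A); [apply: row_base_free | apply: eq_row_base].
Qed.

(** The linear map [q |-> plucker p q] has kernel spanned by [p], hence rank 3, and the nonzero
    vectors of its image are the lines through [p]. *)
Lemma lines_through_plane (p : 'rV[k]_4) : p != 0 ->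
  exists M : 'M[k]_(3, 6), parametrizes M (lines_through p).
Proof.
move=> p0; pose A : 'M[k]_(4, 6) := \matrix_i plucker p (delta_mx 0 i).
have AE q : q *m A = plucker p q.
  rewrite {}/A; case: (row4P p) (row4P q) => ? ? ? ? [? ? ? ?].
  rewrite row_simp; apply/rowP.
  case=> [[|[|[|[|[|[|//]]]]]] lt];
  rewrite !mxE !big_ord_recl big_ord0 !mxE /=; ring.
have pp : plucker p p = 0.
  have := plucker_comb 1 0 1 0 p p.
  by rewrite !scale1r !scale0r addr0 mulr0 mul0r addr0 scale0r.
have rA : \rank A = 3.
  have: (kermx A == p)%MS.
    apply/andP; split.
      apply/row_subP => i; apply: (plucker_eq0) => //; rewrite -AE.
      by rewrite -row_mul mulmx_ker row0.
    by apply/sub_kermxP; rewrite AE.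
  move/eqmxP => kerA; have := mxrank_ker A; rewrite kerA rank_rV p0.
  by case: (\rank A) (rank_leq_row A) => [|[|[|[|[|]]]]].
have [M rM eqMA] := row_free_base rA.
exists M; split=> // u; rewrite eqMA; split.
  move=> [l lu pl]; split; first exact: line_coordinates_neq0 lu.
  have [a [b pE]] := sub_mx2P pl; have [_ [c c0 ->]] := lu.
  apply: scalemx_sub; have plD := plucker_comb a b _ _ (row 0 l) (row 1 l).
  (* A row on which [p] has a nonzero coefficient can be replaced by [p], so up to a scalar the line
     is the image of the other row. *)
  have [a0|a0] := eqVneq a 0.
    have b0 : b != 0.
      by apply: contraNneq p0 => b0; rewrite pE a0 b0 !scale0r addr0.
    have := plD 1 0; rewrite -pE scale1r scale0r addr0 mulr0 mulr1 add0r => E.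
    by rewrite -(scalerK b0 (plucker _ _)) -E -AE scalemx_sub ?submxMl.
  have := plD 0 1; rewrite -pE scale1r scale0r add0r mulr1 mulr0 addr0 => E.
  by rewrite -(scalerK a0 (plucker _ _)) -E -AE scalemx_sub ?submxMl.
move=> [u0 /submxP[q uE]]; move: u0; rewrite uE AE => pq0.
have [l lu [l0 _]] := line_coordinates_plucker pq0; exists l => //.
by rewrite -l0 row_sub.
Qed.

(** The coefficients are the 2 x 2 minors of the matrix with rows [e] and [f]: this is the second
    exterior power of [h]. *)
Lemma plucker_mul3 (e f : 'rV[k]_3) (h : 'M[k]_(3, 4)) :
  plucker (e *m h) (f *m h) =
  (e 0 1 * f 0 2 + e 0 2 * f 0 1) *: plucker (row 1 h) (row 2 h) +
  (e 0 0 * f 0 2 + e 0 2 * f 0 0) *: plucker (row 0 h) (row 2 h) +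
  (e 0 0 * f 0 1 + e 0 1 * f 0 0) *: plucker (row 0 h) (row 1 h).
Proof.
have mul3 (g : 'rV_3) :
    g *m h = g 0 0 *: row 0 h + g 0 1 *: row 1 h + g 0 2 *: row 2 h.
  rewrite mulmx_sum_row !big_ord_recl big_ord0 addr0 addrA.
  have -> : lift ord0 ord0 = 1 :> 'I_3 by apply: val_inj.
  by have -> : lift ord0 (lift ord0 ord0) = 2 :> 'I_3 by apply: val_inj.
rewrite !mul3; case: (row4P (row 0 h)) (row4P (row 1 h)) (row4P (row 2 h)).
move=> ? ? ? ? [? ? ? ?] [? ? ? ?]; rewrite !row_simp.
congr row6; ring2 char2.
Qed.

Lemma row_free_minor (e f : 'rV[k]_3) (i j : 'I_3) (E : 'M[k]_(2, 3)) :
  row 0 E = e -> row 1 E = f ->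
  e 0 i = 1 -> e 0 j = 0 -> f 0 i = 0 -> f 0 j = 1 -> row_free E.
Proof.
move=> rE0 rE1 ei ej fi fj; apply: inj_row_free => v.
rewrite mul_mx2 rE0 rE1 => /rowP v0.
have := v0 i; have := v0 j.
rewrite !mxE ei ej fi fj !mulr0 !mulr1 addr0 add0r => v1 {}v0.
apply/rowP => -[[|[|//]] lt]; rewrite mxE.
  by rewrite -[RHS]v0; congr (v _ _); apply: val_inj.
by rewrite -[RHS]v1; congr (v _ _); apply: val_inj.
Qed.

(** Every nonzero bivector of a three-dimensional space is decomposable. *)
Lemma lines_in_comb (h : 'M[k]_(3, 4)) (x : 'rV[k]_3) : row_free h -> x != 0 ->
  lines_in h (x 0 0 *: plucker (row 1 h) (row 2 h) +
              x 0 1 *: plucker (row 0 h) (row 2 h) +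
              x 0 2 *: plucker (row 0 h) (row 1 h)).
Proof.
(* x is, up to a scalar, the vector of 2 x 2 minors of a 2 x 3 matrix (e; f)
   with an identity block. *)
move=> rh x0; pose row3 (a b c : k) : 'rV_3 := \row_(j < 3) [:: a; b; c]`_j.
suff [c [e [f [i [j [c0 [ei ej fi fj] [x1 x2 x3]]]]]]] :
    exists c (e f : 'rV[k]_3) (i j : 'I_3),
    [/\ c != 0, [/\ e 0 i = 1, e 0 j = 0, f 0 i = 0 & f 0 j = 1]
    & [/\ x 0 0 = c * (e 0 1 * f 0 2 + e 0 2 * f 0 1),
          x 0 1 = c * (e 0 0 * f 0 2 + e 0 2 * f 0 0)
        & x 0 2 = c * (e 0 0 * f 0 1 + e 0 1 * f 0 0)]].
  have [E [E0 E1]] := mx2_rows e f.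
  have rE : row_free E by apply: row_free_minor E0 E1 ei ej fi fj.
  exists (E *m h); last exact: submxMl.
  split; first by rewrite /row_free mxrankMfree.
  exists c => //; rewrite !row_mul E0 E1 plucker_mul3.
  by rewrite x1 x2 x3 !scalerDr !scalerA.
(* The identity block occupies the columns of the minor matching a nonzero coordinate of [x]; that
   coordinate is the factor [c], and the remaining entries are ratios. *)
have [x00|x00] := eqVneq (x 0 0) 0; last first.
  exists (x 0 0), (row3 (x 0 1 / x 0 0) 1 0), (row3 (x 0 2 / x 0 0) 0 1), 1, 2.
  by split=> //; split; rewrite !mxE /=; field.
have [x10|x10] := eqVneq (x 0 1) 0; last first.
  exists (x 0 1), (row3 1 (x 0 0 / x 0 1) 0), (row3 0 (x 0 2 / x 0 1) 1), 0, 2.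
  by split=> //; split; rewrite !mxE /=; field.
have [x20|x20] := eqVneq (x 0 2) 0; last first.
  exists (x 0 2), (row3 1 0 (x 0 0 / x 0 2)), (row3 0 1 (x 0 1 / x 0 2)), 0, 1.
  by split=> //; split; rewrite !mxE /=; field.
case/eqP: x0; apply/rowP => -[[|[|[|//]]] lt]; rewrite mxE.
- by rewrite -[RHS]x00; congr (x _ _); apply: val_inj.
- by rewrite -[RHS]x10; congr (x _ _); apply: val_inj.
- by rewrite -[RHS]x20; congr (x _ _); apply: val_inj.
Qed.

(** The Plücker vectors of the pairs of rows of [h] are independent because each nonzero combination
    of them represents a line. *)
Lemma lines_in_plane (h : 'M[k]_(3, 4)) : row_free h ->
  exists M : 'M[k]_(3, 6), parametrizes M (lines_in h).
Proof.
move=> rh; pose M : 'M[k]_(3, 6) := \matrix_(i < 3)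
  [:: plucker (row 1 h) (row 2 h); plucker (row 0 h) (row 2 h);
      plucker (row 0 h) (row 1 h)]`_i.
have ME x : x *m M = x 0 0 *: plucker (row 1 h) (row 2 h) +
              x 0 1 *: plucker (row 0 h) (row 2 h) +
              x 0 2 *: plucker (row 0 h) (row 1 h).
  rewrite mulmx_sum_row !big_ord_recl big_ord0 addr0 addrA !rowK.
  have -> : lift ord0 ord0 = 1 :> 'I_3 by apply: val_inj.
  by have -> : lift ord0 (lift ord0 ord0) = 2 :> 'I_3 by apply: val_inj.
exists M; split=> [|u].
  apply: inj_row_free => x xM0; apply: contraTeq isT => x0.
  have [l lu _] := lines_in_comb rh x0.
  by have := line_coordinates_neq0 lu; rewrite -ME xM0 eqxx.
split=> [[l lu lh]|[u0 /submxP[x uE]]].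
  split; first exact: line_coordinates_neq0 lu.
  have [_ [c _ ->]] := lu; apply: scalemx_sub.
  have /submxP[E ->] := lh; rewrite !row_mul plucker_mul3.
  set a := _ * _ + _; set b := _ * _ + _; set d := _ * _ + _.
  apply/submxP; exists (\row_(j < 3) [:: a; b; d]`_j).
  by rewrite ME !mxE.
rewrite uE ME; apply: lines_in_comb => //.
by apply: contraNneq u0 => x0; rewrite uE x0 mul0mx.
Qed.

(** * Orthogonal pairs of points on the Grassmannian *)

Lemma polarxx u : polar u u = 0.
Proof. case: (row6P u) => *; rewrite polar_row6; ring2 char2. Qed.

Lemma isotropic_lines u w :
  u != 0 -> pf u = 0 -> pf w = 0 -> polar u w = 0 ->
  exists l l', [/\ line_coordinates l u, w = 0 \/ line_coordinates l' w
                 & (\rank (l + l')%MS < 4)%N].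
Proof.
move=> u0 qu qw uw; have [l lu] := line_of_grassmannian u0 qu.
have [w0|w0] := eqVneq w 0.
  (* When [w] is zero it represents no line, and [l] itself serves as [l']. *)
  exists l, l; split=> //; first by left.
  by rewrite -(polar_lines_eq0 lu lu) polarxx.
have [l' lw] := line_of_grassmannian w0 qw.
exists l, l'; split=> //; first by right.
by rewrite -(polar_lines_eq0 lu lw) uw.
Qed.

(** Two lines whose spans have a sum of rank less than 4 share a point; if [w] is zero, any point of
    the first line will do. *)
Lemma isotropic_lines_through u w :
  u != 0 -> pf u = 0 -> pf w = 0 -> polar u w = 0 ->
  exists2 p : 'rV[k]_4, p != 0 &
    lines_through p u /\ (w = 0 \/ lines_through p w).
Proof.
move=> u0 qu qw uw; have [l [l' [lu lw r4]]] := isotropic_lines u0 qu qw uw.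
have [/eqP rl _] := lu.
have [w0|{}lw] := lw.
  exists (row 0 l).
    apply/eqP => l0; have := row_free_sub_row (row 1 l) (introT eqP rl).
    by rewrite sub_mx2 // l0 sub0mx.
  by split; [exists l => //; apply: row_sub | left].
have [/eqP rl' _] := lw.
have cap0 : (l :&: l')%MS != 0.
  rewrite -mxrank_eq0 -lt0n -(ltn_add2l (\rank (l + l')%MS)) addn0.
  by rewrite mxrank_sum_cap rl rl'.
exists (nz_row (l :&: l')%MS); first by rewrite nz_row_eq0.
have := nz_row_sub (l :&: l')%MS; rewrite sub_capmx => /andP[pl pl'].
by split; [exists l | right; exists l'].
Qed.

(** Dually, some nonzero linear form [n] vanishes on both lines, and its kernel is the required
    plane. *)
Lemma isotropic_lines_in u w :
  u != 0 -> pf u = 0 -> pf w = 0 -> polar u w = 0 ->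
  exists2 h : 'M[k]_(3, 4), row_free h &
    lines_in h u /\ (w = 0 \/ lines_in h w).
Proof.
move=> u0 qu qw uw; have [l [l' [lu lw r4]]] := isotropic_lines u0 qu qw uw.
have coker0 : (cokermx (l + l')%MS)^T != 0.
  by rewrite -mxrank_eq0 mxrank_tr mxrank_coker -lt0n subn_gt0.
set n := nz_row (cokermx (l + l')%MS)^T.
have n0 : n != 0 by rewrite nz_row_eq0.
have ln : (l + l' <= kermx n^T)%MS.
  apply/sub_kermxP; have /submxP[c nE] := nz_row_sub (cokermx (l + l')%MS)^T.
  by rewrite /n nE trmx_mul trmxK mulmxA mulmx_coker mul0mx.
have rn : \rank (kermx n^T) = 3 by rewrite mxrank_ker mxrank_tr rank_rV n0.
have [h rh hE] := row_free_base rn.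
move: ln; rewrite addsmx_sub => /andP[lh lh'].
exists h => //; split; first by exists l; rewrite ?hE.
by case: lw => lw; [left | right; exists l'; rewrite ?hE].
Qed.

(** * Singular points of the conics on these planes *)

Lemma polarity_unit : polarity \in unitmx.
Proof. by have [] := mulmx1_unit polarity_involutive. Qed.

(** The row space of [M] lies in its own orthogonal, which has dimension 6 - 3 = 3 since the polar
    form is nondegenerate; the two therefore coincide. *)
Lemma isotropic_orthogonal_sub (M : 'M[k]_(3, 6)) w : row_free M ->
  M *m polarity *m M^T = 0 -> w *m polarity *m M^T = 0 -> (w <= M)%MS.
Proof.
move=> rM; rewrite -!mulmxA => /sub_kermxP MK /sub_kermxP wK.
suff /eqmxP-> : (M == kermx (polarity *m M^T))%MS by [].
apply/andP; split=> //; rewrite -(geq_leqif (mxrank_leqif_sup MK)).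
rewrite mxrank_ker eqmxMfull ?row_full_unit ?polarity_unit // mxrank_tr.
by rewrite (eqP rM).
Qed.

Lemma parametrizes_isotropic (P : 'rV[k]_6 -> Prop) (M : 'M[k]_(3, 6)) :
  parametrizes M P -> (forall v w, P v -> P w -> polar v w = 0) ->
  M *m polarity *m M^T = 0.
Proof.
case=> rM PM iso; apply/matrixP => i j.
have PMi l : P (row l M).
  apply/PM; rewrite row_sub; split=> //; rewrite rowE.
  rewrite mulmx_free_eq0 //; apply/negP => /eqP/rowP/(_ l).
  by rewrite !mxE !eqxx => /eqP; rewrite oner_eq0.
rewrite [RHS]mxE -[RHS](iso _ _ (PMi i) (PMi j)) /polar -row_mul.
rewrite [LHS]mxE [RHS]mxE.
by apply: eq_bigr => l _; congr (_ * _); rewrite !mxE.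
Qed.

(** The gradient of the restricted quadric is the pairing of [w] with the rows of [M], so it
    vanishes iff [w] lies in their span. The case [w = 0] is listed apart because [P] holds only of
    nonzero vectors. *)
Lemma singular_point_in_planeP (P : 'rV[k]_6 -> Prop) (Q : {mpoly k[6]}) u :
  (exists M : 'M[k]_(3, 6), parametrizes M P) ->
  (forall v w, P v -> P w -> polar v w = 0) ->
  let w := gradient Q u *m polarity in
  singular_point_in_plane P Q u <-> [/\ P u, Q.@[u 0] = 0 & w = 0 \/ P w].
Proof.
move=> exM iso w; have wpol : w *m polarity = gradient Q u.
  by rewrite -mulmxA polarity_involutive mulmx1.
have singE (M : 'M[k]_(3, 6)) (s : 'rV[k]_3) : u = s *m M ->
    (\rank (jacobian [:: pullback Q M] s) < 1)%N = (gradient Q u *m M^T == 0).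
  move=> uE; rewrite ltnS leqn0 mxrank_eq0 uE -gradient_pullback.
  suff -> : jacobian [:: pullback Q M] s = gradient (pullback Q M) s by [].
  by apply/rowP => j; rewrite !mxE.
split.
  move=> [M [s [[rM PM] uE [[s0 Qs] sing]]]].
  have isoM := parametrizes_isotropic (conj rM PM) iso.
  have wM : (w <= M)%MS.
    apply: isotropic_orthogonal_sub => //; rewrite wpol; apply/eqP.
    by rewrite -(singE _ _ uE).
  split.
  - by apply/PM; rewrite uE submxMl mulmx_free_eq0.
  - by rewrite uE -pullback_meval Qs ?mem_head.
  - by have [->|w0] := eqVneq w 0; [left | right; apply/PM].
move=> [Pu Qu Pw]; have [M [rM PM]] := exM.
have isoM := parametrizes_isotropic (conj rM PM) iso.
have [u0 /submxP[s uE]] := (PM u).1 Pu.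
have wM : (w <= M)%MS.
  by case: Pw => [->|/PM[]//]; apply: sub0mx.
exists M, s; split=> //; split; last first.
  rewrite singE // -wpol; have /submxP[c ->] := wM.
  by rewrite -!mulmxA [M *m (_ *m _)]mulmxA isoM mulmx0.
split=> [|f]; first by apply: contraNneq u0 => s0; rewrite uE s0 mul0mx.
by rewrite inE => /eqP->; rewrite pullback_meval -uE.
Qed.

(** Reduces both descriptions of singular lines to two polynomial identities in u, with [w] in the
    role of N u. *)
Lemma singular_lines_areP (Q Q' : {mpoly k[6]}) :
  (forall u, let w := gradient Q u *m polarity in
     polar u w = 0 /\ pf w = Q'.@[u 0]) ->
  singular_lines_are Q Q'.
Proof.
move=> grad u; set w := gradient Q u *m polarity.
have [uw qw] := grad u; rewrite -/w in uw qw.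
have locus : zero_locus (line_complex Q) u -> zero_locus [:: Q'] u <-> pf w = 0.
  move=> [u0 _]; rewrite qw; split=> [[_]|Q'u]; first by apply; apply: mem_head.
  by split=> // f; rewrite inE => /eqP->.
have zero_complex : zero_locus (line_complex Q) u ->
    [/\ u != 0, pf u = 0 & Q.@[u 0] = 0].
  by case=> u0 zu; split; rewrite ?zu // !inE eqxx ?orbT.
have pf0 : pf (0 : 'rV_6) = 0.
  by rewrite -(scale0r 0) grassmannianZ expr0n mul0r.
split; split=> [[zu sing]|[zu /(locus zu) qw0]].
- split=> //; apply/(locus zu); have [p p0 /singular_point_in_planeP] := sing.
  case; [exact: lines_through_plane | exact: polar_lines_through |].
  by rewrite -/w => _ _ [->|[l lw _]] //; apply: grassmannian_line lw.
- split=> //; have [u0 qu Qu] := zero_complex zu.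
  have [p p0 [pu pw]] := isotropic_lines_through u0 qu qw0 uw.
  exists p => //; apply/singular_point_in_planeP => //.
    exact: lines_through_plane.
  exact: polar_lines_through.
- split=> //; apply/(locus zu); have [h rh /singular_point_in_planeP] := sing.
  case; [exact: lines_in_plane | exact: polar_lines_in |].
  by rewrite -/w => _ _ [->|[l lw _]] //; apply: grassmannian_line lw.
- split=> //; have [u0 qu Qu] := zero_complex zu.
  have [h rh [hu hw]] := isotropic_lines_in u0 qu qw0 uw.
  exists h => //; apply/singular_point_in_planeP => //.
    exact: lines_in_plane.
  exact: polar_lines_in.
Qed.

(** * Computation for a common form of the quadrics *)

(* Common form of the three families, with b_i = 0 for the missing terms. *)
Definition quadric (a c d : 'I_3 -> k) (b1 b2 b3 b4 b5 b6 b7 b8 : k) :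
    {mpoly k[6]} :=
  diagonal_part a c d
  + b1 *: (X k i2 * Y k i3) + b2 *: (X k i3 * Y k i2)
  + b3 *: (X k i2 * X k i3) + b4 *: (Y k i2 * Y k i3)
  + b5 *: (X k i1 * Y k i2) + b6 *: (X k i2 * Y k i1)
  + b7 *: (X k i1 * X k i2) + b8 *: (Y k i1 * Y k i2).

Lemma ord3_lift :
  [/\ i1 = ord0, i2 = lift ord0 ord0 & i3 = lift ord0 (lift ord0 ord0)].
Proof. by split; apply: val_inj. Qed.

(** Stated on the underlying numbers so that it computes once the indices are concrete. *)
Lemma meval_mderivXU (v : 'I_6 -> k) i j :
  ('X_i)^`M(j).@[v] = (val i == val j)%:R.
Proof.
rewrite mderivX mnm1E val_eqE mevalZ.
case: eqP => [->|_]; last by rewrite mul0r.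
by rewrite submm mpolyX0 meval1 mulr1.
Qed.

(** Squares have zero derivative in characteristic 2, so only the mixed terms contribute. *)
Lemma gradient_quadric a c d b1 b2 b3 b4 b5 b6 b7 b8 x1 x2 x3 y1 y2 y3 :
  gradient (quadric a c d b1 b2 b3 b4 b5 b6 b7 b8) (row6 x1 x2 x3 y1 y2 y3) =
  row6 (a i1 * y1 + b5 * y2 + b7 * x2)
       (a i2 * y2 + b1 * y3 + b3 * x3 + b6 * y1 + b7 * x1)
       (a i3 * y3 + b2 * y2 + b3 * x2)
       (a i1 * x1 + b6 * x2 + b8 * y2)
       (a i2 * x2 + b2 * x3 + b4 * y3 + b5 * x1 + b8 * y1)
       (a i3 * x3 + b1 * x2 + b4 * y2).
Proof.
have [-> -> ->] := ord3_lift.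
apply/rowP => j; rewrite mxE /quadric /diagonal_part.
rewrite !big_ord_recl big_ord0 addr0 /X /Y !expr2.
rewrite !(mderivD, mderivZ, mderivM) !(mevalD, mevalZ, mevalM, mevalXU).
rewrite !meval_mderivXU.
rewrite !mxE; case: j => [[|[|[|[|[|[|//]]]]]] lt] /=; ring2 char2.
Qed.

(* The form u |-> G (N u) for Q = quadric, where the other mixed terms vanish
   under the hypotheses of [singular_lines_quadric]. *)
Definition dual_quadric (a : 'I_3 -> k) (b1 b2 b3 b4 b5 b6 b7 b8 : k) :
    {mpoly k[6]} :=
  \sum_(i < 3) a i ^+ 2 *: (X k i * Y k i)
  + (b5 * b7) *: X k i1 ^+ 2 + (b1 * b3 + b6 * b7) *: X k i2 ^+ 2
  + (b2 * b3) *: X k i3 ^+ 2 + (b6 * b8) *: Y k i1 ^+ 2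
  + (b2 * b4 + b5 * b8) *: Y k i2 ^+ 2 + (b1 * b4) *: Y k i3 ^+ 2
  + (b1 * b5 + b4 * b7) *: (X k i1 * Y k i3)
  + (b2 * b6 + b3 * b8) *: (X k i3 * Y k i1)
  + (b2 * b7 + b3 * b5) *: (X k i1 * X k i3)
  + (b1 * b8 + b4 * b6) *: (Y k i1 * Y k i3).

Lemma dual_quadric_row6 a b1 b2 b3 b4 b5 b6 b7 b8 x1 x2 x3 y1 y2 y3 :
  (dual_quadric a b1 b2 b3 b4 b5 b6 b7 b8).@[row6 x1 x2 x3 y1 y2 y3 0] =
  a i1 ^+ 2 * (x1 * y1) + a i2 ^+ 2 * (x2 * y2) + a i3 ^+ 2 * (x3 * y3)
  + b5 * b7 * x1 ^+ 2 + (b1 * b3 + b6 * b7) * x2 ^+ 2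
  + b2 * b3 * x3 ^+ 2 + b6 * b8 * y1 ^+ 2
  + (b2 * b4 + b5 * b8) * y2 ^+ 2 + b1 * b4 * y3 ^+ 2
  + (b1 * b5 + b4 * b7) * (x1 * y3) + (b2 * b6 + b3 * b8) * (x3 * y1)
  + (b2 * b7 + b3 * b5) * (x1 * x3) + (b1 * b8 + b4 * b6) * (y1 * y3).
Proof.
have [-> -> ->] := ord3_lift.
rewrite /dual_quadric !big_ord_recl big_ord0 addr0 /X /Y !expr2.
rewrite !(mevalD, mevalZ, mevalM, mevalXU) !mxE /= !addrA; ring.
Qed.

(** Expanding G(N u) gives the dual quadric plus multiples of a1 + a2, a2 + a3, b1 b2 + b3 b4 and b5
    b6 + b7 b8; the hypotheses make all four extra terms vanish. *)
Lemma singular_lines_quadric a c d b1 b2 b3 b4 b5 b6 b7 b8 :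
  b1 * b2 = b3 * b4 -> b5 * b6 = b7 * b8 ->
  a i1 = a i2 \/ [/\ b5 = 0, b6 = 0, b7 = 0 & b8 = 0] ->
  a i2 = a i3 \/ [/\ b1 = 0, b2 = 0, b3 = 0 & b4 = 0] ->
  singular_lines_are (quadric a c d b1 b2 b3 b4 b5 b6 b7 b8)
                     (dual_quadric a b1 b2 b3 b4 b5 b6 b7 b8).
Proof.
move=> b12 b56 a12 a23; apply: singular_lines_areP => // u w; rewrite /w.
case: (row6P u) => x1 x2 x3 y1 y2 y3; rewrite gradient_quadric row6_polarity.
rewrite polar_row6 grassmannian_row6 dual_quadric_row6.
(* By Euler's formula the pairing of u with N u is twice the mixed part of the quadric. *)
split; first by ring2 char2.
have addxx (x : k) : x + x = 0 by rewrite addrr_pchar2.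
have b34 : b1 * b2 + b3 * b4 = 0 by rewrite b12 addxx.
have b78 : b5 * b6 + b7 * b8 = 0 by rewrite b56 addxx.
have c12 : (a i1 + a i2) *
    (b5 * (x1 * y2) + b6 * (x2 * y1) + b7 * (x1 * x2) + b8 * (y1 * y2)) = 0.
  by case: a12 => [->|[-> -> -> ->]]; rewrite ?addxx !mul0r ?addr0 ?mulr0.
have c23 : (a i2 + a i3) *
    (b1 * (x2 * y3) + b2 * (x3 * y2) + b3 * (x2 * x3) + b4 * (y2 * y3)) = 0.
  by case: a23 => [->|[-> -> -> ->]]; rewrite ?addxx !mul0r ?addr0 ?mulr0.
(* The four vanishing terms are added to the right-hand side, after which both sides agree as
   polynomials. *)
rewrite -[RHS]addr0 -c12 -[RHS]addr0 -c23 -[RHS]addr0.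
rewrite -[X in _ = _ + X](mulr0 (x1 * y1 + x2 * y2)) -[X in _ = _ + _ * X]b78.
rewrite -[RHS]addr0 -[X in _ = _ + X](mulr0 (x2 * y2 + x3 * y3)).
rewrite -[X in _ = _ + _ * X]b34; ring.
Qed.

End LineComplexes.

(** * Specialisation to the three families *)

Theorem theorem1p2 (k : closedFieldType) (char2 : 2%N \in [pchar k]) :
  [/\ (forall a c d : 'I_3 -> k,
         injective a ->
         nonsingular (line_complex (quadric_a a c d)) ->
         singular_lines_are (quadric_a a c d) (sing_quadric_a a)),
      (forall (a c d alpha beta gamma delta : 'I_3 -> k) (b1 b2 b3 b4 : k),
         a i1 != a i2 -> a i2 = a i3 ->
         (forall i, alpha i * delta i + beta i * gamma i = 1) ->
         b1 = beta i3 * gamma i2 -> b2 = alpha i2 * delta i3 ->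
         b3 = gamma i2 * delta i3 -> b4 = alpha i2 * beta i3 ->
         nonsingular (line_complex (quadric_b a c d b1 b2 b3 b4)) ->
         singular_lines_are (quadric_b a c d b1 b2 b3 b4)
                            (sing_quadric_b a b1 b2 b3 b4))
    & (forall (a : k) (c d alpha beta gamma delta : 'I_3 -> k)
              (b1 b2 b3 b4 b5 b6 b7 b8 : k),
         (forall i, alpha i * delta i + beta i * gamma i = 1) ->
         b1 = beta i3 * gamma i2 -> b2 = alpha i2 * delta i3 ->
         b3 = gamma i2 * delta i3 -> b4 = alpha i2 * beta i3 ->
         b5 = beta i2 * gamma i1 -> b6 = alpha i1 * delta i2 ->
         b7 = gamma i1 * delta i2 -> b8 = alpha i1 * beta i2 ->
         nonsingular (line_complex (quadric_c a c d b1 b2 b3 b4 b5 b6 b7 b8)) ->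
         singular_lines_are (quadric_c a c d b1 b2 b3 b4 b5 b6 b7 b8)
                            (sing_quadric_c a b1 b2 b3 b4 b5 b6 b7 b8))].
Proof.
split=> [a c d _ _|a c d al be ga de b1 b2 b3 b4 _ a23 _ b1E b2E b3E b4E _
        |a c d al be ga de b1 b2 b3 b4 b5 b6 b7 b8 _].
- have -> : quadric_a a c d = quadric a c d 0 0 0 0 0 0 0 0.
    by rewrite /quadric !scale0r !addr0.
  have -> : sing_quadric_a a = dual_quadric a 0 0 0 0 0 0 0 0.
    by rewrite /dual_quadric !mulr0 !addr0 !scale0r !addr0.
  by apply: singular_lines_quadric => //; right.
- have -> : quadric_b a c d b1 b2 b3 b4 = quadric a c d b1 b2 b3 b4 0 0 0 0.
    by rewrite /quadric !scale0r !addr0.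
  have -> : sing_quadric_b a b1 b2 b3 b4 = dual_quadric a b1 b2 b3 b4 0 0 0 0.
    by rewrite /dual_quadric !(mulr0, mul0r) !addr0 !scale0r !addr0.
  apply: singular_lines_quadric => //; [|by right|by left].
  (* Both b1 b2 and b3 b4 equal the product of [al i2], [be i3], [ga i2] and [de i3]. *)
  by rewrite b1E b2E b3E b4E; ring.
- move=> b1E b2E b3E b4E b5E b6E b7E b8E _.
  (* [quadric_c] already unfolds to [quadric] with constant [a]; in the dual quadric a^2 has to be
     distributed over the sum. *)
  have -> : sing_quadric_c a b1 b2 b3 b4 b5 b6 b7 b8 =
      dual_quadric (fun=> a) b1 b2 b3 b4 b5 b6 b7 b8.
    by rewrite /sing_quadric_c scaler_sumr.
  apply: (singular_lines_quadric char2 (a := fun=> a)); [| |by left|by left].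
    by rewrite b1E b2E b3E b4E; ring.
  by rewrite b5E b6E b7E b8E; ring.
Qed.
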